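(* Let $\Gamma$ be any 2-agent zero-sum game in which all entries of $A=A^{(12)}$ are distinct. Then a probability measure $\pi$ on $\mathcal{X}$ is a stationary distribution of the Feller chain $\{X^t\}$ on $\mathcal{X}$ generated by Stochastic MWU if and only if $\pi$ is concentrated on pure strategy profiles (i.e., $\pi(x)>0$ only when $x$ is a pure strategy profile).
   Context: Two agents with finite pure strategy sets $\mathcal{S}_1,\mathcal{S}_2$, $\mathcal{S}=\mathcal{S}_1\times\mathcal{S}_2$, simplices $\mathcal{X}_i$ of mixed strategies, $\mathcal{X}=\mathcal{X}_1\times\mathcal{X}_2$; $A^{(12)}=A$, $A^{(21)}=-A^\top$. A pure strategy profile is $x=(e_{s_1},e_{s_2})$. The chain has kernel $P(x,\{z\})=\sum_{s\in\mathcal{S}:\,R(s,x)=z}\prod_i x_{is_i}$, where $R_{i\hat s}(s,x)=\dfrac{x_{i\hat s}\exp(\eta_i\langle e_{\hat s},A^{(ij)}e_{s_j}\rangle)}{\sum_{\bar s\in\mathcal{S}_i}x_{i\bar s}\exp(\eta_i\langle e_{\bar s},A^{(ij)}e_{s_j}\rangle)}$ ($j\ne i$, $0/0=0$) is the Stochastic MWU update after sampling pure profile $s$ from $x$. $\pi$ is stationary if $\int_{\mathcal{X}}\pi(dx)P(x,A')=\pi(A')$ for all Borel $A'\subseteq\mathcal{X}$. *)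

(* Defs.v *)
From HB Require Import structures.
From mathcomp Require Import all_boot all_order all_algebra.
From mathcomp Require Import all_classical all_reals all_analysis.
Set Implicit Arguments. Unset Strict Implicit. Unset Printing Implicit Defensive.
Import Order.TTheory GRing.Theory Num.Theory.
Local Open Scope classical_set_scope.
Local Open Scope ring_scope.

Section SMWU.
Variables (R : realType) (n1 n2 : nat).

(* A mixed strategy profile lives in R^{n1} x R^{n2}, represented as a pair of
   tuples; this type carries the product (= Borel) sigma-algebra. *)
Definition profile := (n1.-tuple R * n2.-tuple R)%type.

Definition simplex n : set (n.-tuple R) :=
  [set x | (forall i : 'I_n, 0 <= tnth x i) /\ \sum_(i < n) tnth x i = 1].

Definition Xspace : set profile := @simplex n1 `*` @simplex n2.

Definition basis_vec n (s : 'I_n) : n.-tuple R := [tuple (i == s)%:R | i < n].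

Definition pure_profiles : set profile :=
  [set x | exists (s1 : 'I_n1) (s2 : 'I_n2), x = (basis_vec s1, basis_vec s2)].

(* Stochastic MWU update R(s, x) for the zero-sum game A^(12) = A,
   A^(21) = - A^T, with learning rates eta1, eta2.  Division by 0 gives 0
   in MathComp, matching the 0/0 = 0 convention. *)
Definition mwu_update (A : 'M[R]_(n1, n2)) (eta1 eta2 : R)
    (s : 'I_n1 * 'I_n2) (x : profile) : profile :=
  ([tuple tnth x.1 h * expR (eta1 * A h s.2) /
           (\sum_(b < n1) tnth x.1 b * expR (eta1 * A b s.2)) | h < n1],
   [tuple tnth x.2 h * expR (eta2 * (- A s.1 h)) /
           (\sum_(b < n2) tnth x.2 b * expR (eta2 * (- A s.1 b))) | h < n2]).

Definition smwu_kernel (A : 'M[R]_(n1, n2)) (eta1 eta2 : R)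
    (x : profile) (B : set profile) : \bar R :=
  (\sum_(s : 'I_n1 * 'I_n2)
     (tnth x.1 s.1 * tnth x.2 s.2)%:E * \d_(mwu_update A eta1 eta2 s x) B)%E.

Definition smwu_stationary (A : 'M[R]_(n1, n2)) (eta1 eta2 : R)
    (pi : probability profile R) : Prop :=
  forall B : set profile, measurable B -> B `<=` Xspace ->
    (\int[pi]_(x in Xspace) smwu_kernel A eta1 eta2 x B = pi B)%E.

End SMWU.

(* Main.v *)
Require Import Defs.
From HB Require Import structures.
From mathcomp Require Import all_boot all_order all_algebra.
From mathcomp Require Import all_classical all_reals all_analysis.
From mathcomp Require Import measurable_realfun measurable_fun_approximation lra ring.
Import Order.TTheory GRing.Theory Num.Theory.
Import numFieldNormedType.Exports HBNNSimple.
Local Open Scope classical_set_scope.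
Local Open Scope ring_scope.
Set Implicit Arguments. Unset Strict Implicit. Unset Printing Implicit Defensive.

(* The supports S1, S2 of the two mixed strategies never change, so every face
   of X is invariant.  On a face take
     L(x) = eta1^-1 <p, ln x1> + eta2^-1 <q, ln x2>
   with signed weights p, q supported in S1, S2 and of equal total mass a.  Its
   expected increment is <p, A x2> - <x1, A q> minus a times the sum of the two
   Jensen gaps of the log-normalizers.  Linear algebra alone provides p, q such
   that <p, A x2> - <x1, A q> is constant on the face, with either a = 1 and
   constant 0, or a = 0 and a negative constant.  As the entries of A are
   distinct, a Jensen gap is positive unless S1 and S2 are singletons, so on
   every other face L has negative drift, and bounded increments.  By
   stationarity the truncations of L have mean increment 0, hence so does L by
   dominated convergence, and the face is null. *)

(** * Linear algebra: a Fredholm alternative and the signed weights of a face *)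

Lemma mulmx_alternative (F : fieldType) (m n : nat) (A : 'M[F]_(m, n)) (u : 'rV[F]_n) :
  (exists w : 'rV_m, w *m A = u) \/
  (exists2 y : 'cV_n, A *m y = 0 & u *m y = 1%:M).
Proof.
case: (boolP (u <= A)%MS) => [/submxP[w ->]|]; first by left; exists w.
(* The columns of the cokernel matrix [K] lie in the right kernel of [A]. A row outside the row
   space is not annihilated by [K], so some column of [K] pairs nontrivially with [u] and only has
   to be rescaled. *)
rewrite submxE; move: (cokermx A) (mulmx_coker A) => K AK /matrix0Pn[i [j nz]]; right.
exists (((u *m K) i j)^-1 *: col j K); rewrite colE -scalemxAr mulmxA.
  by rewrite AK mul0mx scaler0.
rewrite -colE; move: nz; rewrite (ord1 i) => nz; apply/matrixP => k l.
by move: nz; rewrite !ord1 !mxE eqxx; exact: mulVf.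
Qed.

(* With a = 1 and c = d this is the indifference condition of an interior
   equilibrium, except that p and q may have negative entries: an interior
   equilibrium need not exist, but a solution of one of the two kinds does. *)
Lemma bordered_solution (F : realFieldType) (m n : nat) (A : 'M[F]_(m, n))
    (u : 'rV[F]_m) (v : 'rV[F]_n) :
  exists (p : 'rV[F]_m) (q : 'rV[F]_n) (a c d : F),
  [/\ p *m A = c *: v, A *m q^T = d *: u^T,
      p *m u^T = a%:M, v *m q^T = a%:M &
      (a = 1 /\ c = d) \/ (a = 0 /\ c < d)].
Proof.
have [[p pA]|[y Ay vy]] := mulmx_alternative A v;
have [[q qA]|[z Az uz]] := mulmx_alternative A^T u.
- have Aq : A *m q^T = u^T by rewrite -qA trmx_mul trmxK.
  (* Both sides equal [p *m A *m q^T], so the masses of [p] and [q] agree automatically. *)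
  have E : p *m u^T = v *m q^T by rewrite -Aq -pA mulmxA.
  have [s sE] : exists s, p *m u^T = s%:M.
    by exists ((p *m u^T) 0 0); rewrite -mx11_scalar.
  (* If the common mass is zero it cannot be normalized, but then [- p] paired with zero already
     gives [c = -1 < 0 = d]. Otherwise dividing by the mass gives [c = d = s^-1]. *)
  have [s0|s0] := eqVneq s 0.
    exists (- p), 0, 0, (-1), 0; split.
    + by rewrite mulNmx pA scaleN1r.
    + by rewrite trmx0 mulmx0 scale0r.
    + by rewrite mulNmx sE s0 -scalemx1 scale0r oppr0.
    + by rewrite trmx0 mulmx0 -scalemx1 scale0r.
    + by right; split => //; rewrite oppr_lt0.
  exists (s^-1 *: p), (s^-1 *: q), 1, s^-1, s^-1; split.
  + by rewrite -scalemxAl pA.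
  + by rewrite linearZ /= -scalemxAr Aq.
  + by rewrite -scalemxAl sE -scalemx1 scalerA mulVf // scalemx1.
  + by rewrite linearZ /= -scalemxAr -E sE -scalemx1 scalerA mulVf // scalemx1.
  + by left.
- have zA : z^T *m A = 0 by rewrite -[A]trmxK -trmx_mul Az trmx0.
  have zu : z^T *m u^T = 1%:M by rewrite -trmx_mul uz trmx1.
  have [s sE] : exists s, p *m u^T = s%:M.
    by exists ((p *m u^T) 0 0); rewrite -mx11_scalar.
  (* The row [z^T] has mass 1 and is killed by [A], so adding [s *: z^T] cancels the mass of [- p]
     without changing its image. *)
  exists (s *: z^T - p), 0, 0, (-1), 0; split.
  + by rewrite mulmxBl -scalemxAl zA scaler0 sub0r pA scaleN1r.
  + by rewrite trmx0 mulmx0 scale0r.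
  + by rewrite mulmxBl -scalemxAl zu sE scalemx1 subrr -scalemx1 scale0r.
  + by rewrite trmx0 mulmx0 -scalemx1 scale0r.
  + by right; split => //; rewrite oppr_lt0.
- have Aq : A *m q^T = u^T by rewrite -qA trmx_mul trmxK.
  have [s sE] : exists s, v *m q^T = s%:M.
    by exists ((v *m q^T) 0 0); rewrite -mx11_scalar.
  (* The mirror image: the kernel vector [y] removes the mass of [q], and now [c = 0 < 1 = d]. *)
  exists 0, (q - s *: y^T), 0, 0, 1; split.
  + by rewrite mul0mx scale0r.
  + by rewrite linearB linearZ /= trmxK mulmxBr -scalemxAr Ay scaler0 subr0 Aq scale1r.
  + by rewrite mul0mx -scalemx1 scale0r.
  + by rewrite linearB linearZ /= trmxK mulmxBr -scalemxAr vy sE scalemx1 subrr -scalemx1 scale0r.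
  + by right; split => //; exact: ltr01.
- exists z^T, y^T, 1, 0, 0; split.
  + by rewrite scale0r -[A]trmxK -trmx_mul Az trmx0.
  + by rewrite trmxK scale0r Ay.
  + by rewrite -trmx_mul uz trmx1.
  + by rewrite trmxK vy.
  + by left.
Qed.

Lemma face_weights (F : realFieldType) (m n : nat) (A : 'M[F]_(m, n))
    (S1 : {set 'I_m}) (S2 : {set 'I_n}) :
  exists (p : 'I_m -> F) (q : 'I_n -> F) (a c d : F),
  [/\ forall j, j \in S2 -> \sum_(i in S1) p i * A i j = c,
      forall i, i \in S1 -> \sum_(j in S2) q j * A i j = d,
      \sum_(i in S1) p i = a, \sum_(j in S2) q j = a &
      (a = 1 /\ c = d) \/ (a = 0 /\ c < d)].
Proof.
(* Zeroing the entries outside [S1] and [S2] and taking indicators for [u] and [v] imitates the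
   submatrix without changing index types. Only the equations indexed by [S1] and [S2] are read
   off. *)
pose B : 'M[F]_(m, n) := \matrix_(i, j) (A i j *+ ((i \in S1) && (j \in S2))).
pose u : 'rV[F]_m := \row_i (i \in S1)%:R.
pose v : 'rV[F]_n := \row_j (j \in S2)%:R.
have [p [q [a [c [d [pB Bq pu vq H]]]]]] := bordered_solution B u v.
exists (fun i => p 0 i), (fun j => q 0 j), a, c, d; split => //.
- move=> j jS; have := congr1 (fun M : 'rV_n => M 0 j) pB; rewrite !mxE jS mulr1 => <-.
  rewrite big_mkcond; apply: eq_bigr => i _.
  by rewrite mxE jS andbT; case: (i \in S1); rewrite ?mulr0.
- move=> i iS; have := congr1 (fun M : 'cV_m => M i 0) Bq; rewrite !mxE iS mulr1 => <-.
  rewrite big_mkcond; apply: eq_bigr => j _.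
  by rewrite !mxE iS /=; case: (j \in S2); rewrite ?mul0r // mulrC.
- have := congr1 (fun M : 'M[F]_1 => M 0 0) pu; rewrite !mxE eqxx mulr1n => <-.
  rewrite big_mkcond; apply: eq_bigr => i _.
  by rewrite !mxE; case: (i \in S1); rewrite ?mulr0 ?mulr1.
- have := congr1 (fun M : 'M[F]_1 => M 0 0) vq; rewrite !mxE eqxx mulr1n => <-.
  rewrite big_mkcond; apply: eq_bigr => j _.
  by rewrite !mxE; case: (j \in S2); rewrite ?mul0r ?mul1r.
Qed.

(** * Jensen's inequality for the logarithm of an average of exponentials *)

Section JensenLn.
Context {R : realType} {n : nat}.
Variables (x u : 'I_n -> R).
Hypotheses (x_ge0 : forall i, 0 <= x i) (x_sum1 : \sum_i x i = 1).

Let m := \sum_i x i * u i.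

(** The bracket is the tangent line of the exponential at the mean [m], evaluated at [u i]; its
    linear term averages to zero. *)
Let tangent_mean : \sum_i x i * (expR m * (1 + (u i - m))) = expR m.
Proof.
rewrite (eq_bigr (fun i => expR m * (x i * (1 - m) + x i * u i))); last by move=> i _; ring.
by rewrite -mulr_sumr big_split /= -mulr_suml x_sum1 -/m mul1r subrK mulr1.
Qed.

Let tangent_le i : x i * (expR m * (1 + (u i - m))) <= x i * expR (u i).
Proof.
by rewrite ler_wpM2l // -[u i in leRHS](subrKC m) expRD ler_wpM2l ?expR_ge0 // expR_ge1Dx.
Qed.

Lemma jensen_ln_sum_expR : \sum_i x i * u i <= ln (\sum_i x i * expR (u i)).
Proof.
have le : expR m <= \sum_i x i * expR (u i) by rewrite -[leLHS]tangent_mean ler_sum.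
by rewrite -[leLHS]expRK ler_ln ?posrE ?expR_gt0 // (lt_le_trans (expR_gt0 m)).
Qed.

(** Two different values cannot both equal the mean. At one that differs from it, and has positive
    weight, the exponential lies strictly above its tangent. *)
Lemma jensen_ln_sum_expR_lt a b : 0 < x a -> 0 < x b -> u a != u b ->
  \sum_i x i * u i < ln (\sum_i x i * expR (u i)).
Proof.
move=> xa xb uab.
have [k xk uk] : exists2 k, 0 < x k & u k != m.
  have [ua|ua] := eqVneq (u a) m; last by exists a.
  by exists b => //; rewrite -ua eq_sym.
have lt : expR m < \sum_i x i * expR (u i).
  rewrite -[ltLHS]tangent_mean (bigD1 k) // [ltRHS](bigD1 k) //=.
  apply: ltr_leD; last by apply: ler_sum.
  rewrite ltr_pM2l // -[u k in ltRHS](subrKC m) expRD ltr_pM2l ?expR_gt0 //.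
  by rewrite expR_gt1Dx // subr_eq0.
by rewrite -[ltLHS]expRK ltr_ln ?posrE ?expR_gt0 // (lt_trans (expR_gt0 m)).
Qed.

End JensenLn.

(** * Truncation of real functions *)

Section Clamp.
Context {R : realFieldType}.

Definition clamp (M t : R) : R := Num.max (- M) (Num.min M t).

Lemma clamp_ge (M t : R) : - M <= clamp M t.
Proof. by rewrite /clamp le_max lexx. Qed.

Lemma clamp_norm (M t : R) : 0 <= M -> `|clamp M t| <= M.
Proof.
move=> M0; rewrite ler_norml clamp_ge /clamp ge_max ge_min lexx andbT.
by rewrite (le_trans _ M0) // oppr_le0.
Qed.

Lemma clamp_id (M t : R) : `|t| <= M -> clamp M t = t.
Proof.
by rewrite ler_norml /clamp => /andP[h1 h2]; rewrite (min_r h2) (max_r h1).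
Qed.

(** This bounds the increments of every truncation by those of the function itself, uniformly in
    [M], which supplies the dominating constant for the limit. *)
Lemma clamp_lipschitz (M a b : R) : 0 <= M -> `|clamp M a - clamp M b| <= `|a - b|.
Proof.
move=> M0; rewrite /clamp !maxEle !minEle.
case: (lerP M a) => ?; case: (lerP M b) => ?; case: (lerP (- M) M) => ?;
case: (lerP (- M) a) => ?; case: (lerP (- M) b) => ?;
rewrite ler_norml; case: (ger0P (a - b)) => ?; apply/andP; split; lra.
Qed.

End Clamp.

Lemma measurable_clamp d (T : measurableType d) (R : realType) (M : R) (F : T -> R) :
  measurable_fun setT F -> measurable_fun setT (fun x => clamp M (F x)).
Proof.
by move=> mF; exact: (measurable_maxr (measurable_cst _)
  (measurable_minr (measurable_cst _) mF)).
Qed.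

Lemma bounded_integrable d (T : measurableType d) (R : realType)
    (mu : {finite_measure set T -> \bar R}) (D : set T) (F : T -> R) (K : R) :
  measurable D -> measurable_fun D F -> (forall x, D x -> `|F x| <= K) ->
  mu.-integrable D (EFin \o F).
Proof.
move=> mD mF FK.
apply: (le_integrable mD _ _ (finite_measure_integrable_cst mu K mD)).
  exact/measurable_EFinP.
by move=> x Dx /=; rewrite lee_fin (le_trans (FK x Dx)) // ler_norm.
Qed.

Lemma cvg_clamp (R : realType) (t : R) : clamp n%:R t @[n --> \oo] --> t.
Proof.
apply: cvg_near_cst; near=> n; apply: clamp_id.
by near: n; exact: nbhs_infty_ger.
Unshelve. all: by end_near. Qed.

(** * Stationary measures of chains with finitely many random maps *)

Section FiniteBranching.
Context d (T : measurableType d) (R : realType) (I : finType).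
Variables (pi : probability T R) (X : set T) (w : I -> T -> R) (r : I -> T -> T).
Hypothesis mX : measurable X.
Hypothesis mw : forall i, measurable_fun setT (w i).
Hypothesis mr : forall i, measurable_fun setT (r i).
Hypothesis w_ge0 : forall i x, X x -> 0 <= w i x.
Hypothesis stat : forall B, measurable B ->
  (\int[pi]_(x in X) (\sum_i w i x * \1_B (r i x))%:E = pi B)%E.

Let ge0K (g : T -> \bar R) x : X x -> (forall z, 0 <= g z)%E ->
  (0 <= \sum_i (w i x)%:E * g (r i x))%E.
Proof. by move=> Xx g0; apply: sume_ge0 => i _; rewrite mule_ge0 ?lee_fin ?w_ge0. Qed.

Let mK (g : T -> \bar R) : measurable_fun setT g ->
  measurable_fun X (fun x => \sum_i (w i x)%:E * g (r i x))%E.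
Proof.
move=> mg; apply: emeasurable_sum => i; apply: emeasurable_funM.
  by apply/measurable_EFinP; apply: measurable_funTS.
by apply: measurable_funTS; exact: measurableT_comp.
Qed.

Let stat_nnsfun (f : {nnsfun T >-> R}) :
  (\int[pi]_(x in X) \sum_i (w i x)%:E * (f (r i x))%:E = \int[pi]_x (f x)%:E)%E.
Proof.
pose s : seq R := finmap.enum_fset (fset_set (range f)).
have fE z : f z = \sum_(y <- s) y * \1_(f @^-1` [set y]) z.
  by rewrite {1}fimfunE fsbig_finite.
have nn (y : R) z : 0 <= y * \1_(f @^-1` [set y]) z.
  rewrite indicE; case: (boolP (z \in _)) => [|_]; last by rewrite mulr0.
  by rewrite inE /= => <-; rewrite mulr1.
under [RHS]eq_integral do rewrite fE -sumEFin.
rewrite [RHS]ge0_integral_sum //=; last 2 first.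
- by move=> y; apply/measurable_EFinP; apply: measurable_funM.
- by move=> y z _; rewrite lee_fin.
transitivity (\int[pi]_(x in X) \sum_(y <- s)
    (y * \sum_i w i x * \1_(f @^-1` [set y]) (r i x))%:E)%E.
  apply: eq_integral => x _.
  rewrite (eq_bigr (fun i => (w i x * f (r i x))%:E)) // !sumEFin; congr EFin.
  under eq_bigr do rewrite fE mulr_sumr.
  rewrite exchange_big /=; apply: eq_bigr => y _.
  by rewrite mulr_sumr; apply: eq_bigr => i _; rewrite mulrCA.
have mk y : measurable_fun X (fun x => (\sum_i w i x * \1_(f @^-1` [set y]) (r i x))%:E).
  apply/measurable_EFinP/measurable_sum => i; apply: measurable_funM.
    exact: measurable_funTS.
  by apply: measurable_funTS; apply: measurableT_comp.
rewrite ge0_integral_sum //=; last 2 first.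
- move=> y; under eq_fun do rewrite EFinM; exact: measurable_funeM.
- move=> y x Xx; rewrite lee_fin mulr_sumr sumr_ge0 // => i _.
  by rewrite mulrCA mulr_ge0 ?w_ge0.
apply: eq_bigr => y _.
under eq_integral do rewrite EFinM.
under [RHS]eq_integral do rewrite EFinM.
(* Pulling out the constant needs [0 <= y]. A negative [y] has empty preimage because [f] is
   nonnegative, and both integrals vanish. *)
have [y0|y0] := leP 0 y; last first.
  have -> : f @^-1` [set y] = set0.
    apply/seteqP; split=> z //= fzy.
    have : 0 <= f z by []; by rewrite fzy leNgt y0.
  rewrite !integral0_eq // => x _; first by rewrite indic0 mule0.
  by rewrite big1 ?mule0 // => i _; rewrite indic0 mulr0.
rewrite !ge0_integralZl_EFin //=.
- by rewrite stat // integral_indic // setIT.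
- by apply/measurable_EFinP.
- by move=> x Xx; rewrite lee_fin sumr_ge0 // => i _; rewrite mulr_ge0 ?w_ge0.
Qed.

(** The hypothesis [stat] is the case of indicators and linearity gives simple functions. Monotone
    convergence does the rest: a finite sum with nonnegative weights preserves increasing limits. *)
Lemma stationary_ge0_integral (g : T -> \bar R) :
  measurable_fun setT g -> (forall x, 0 <= g x)%E ->
  (\int[pi]_(x in X) \sum_i (w i x)%:E * g (r i x) = \int[pi]_x g x)%E.
Proof.
move=> mg g0; pose f := nnsfun_approx measurableT mg.
have cf x : (EFin \o f^~ x) @ \oo --> g x by apply: cvg_nnsfun_approx.
have nd x : {homo (fun n => (f n x)%:E) : m n / (m <= n)%N >-> (m <= n)%E}.
  by move=> m n mn; rewrite lee_fin; exact/lefP/nd_nnsfun_approx.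
have l1 : (\int[pi]_x (f n x)%:E)%E @[n --> \oo] --> (\int[pi]_x g x)%E.
  rewrite (_ : (\int[pi]_x g x)%E = (\int[pi]_x limn (fun n => (f n x)%:E))%E); last first.
    by apply: eq_integral => x _; apply/esym/cvg_lim => //; exact: cf.
  apply: cvg_monotone_convergence => //.
  - by move=> n; exact/measurable_EFinP.
  - by move=> n x _; rewrite lee_fin.
have l2 : (\int[pi]_(x in X) (\sum_i (w i x)%:E * (f n (r i x))%:E))%E @[n --> \oo] -->
    (\int[pi]_(x in X) \sum_i (w i x)%:E * g (r i x))%E.
  have Kc x : X x -> (\sum_i (w i x)%:E * (f n (r i x))%:E)%E @[n --> \oo] -->
      (\sum_i (w i x)%:E * g (r i x))%E.
    move=> Xx; apply: cvg_nnesum => [i _|i _].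
      by apply: nearW => n; rewrite mule_ge0 ?lee_fin ?w_ge0.
    by apply: cvgeZl => //; exact: cf.
  rewrite (_ : (\int[pi]_(x in X) \sum_i (w i x)%:E * g (r i x))%E =
     (\int[pi]_(x in X) limn (fun n => \sum_i (w i x)%:E * (f n (r i x))%:E))%E); last first.
    by apply: eq_integral => x /[!inE] Xx; apply/esym/cvg_lim => //; exact: Kc.
  apply: cvg_monotone_convergence => //.
  - by move=> n; apply: (mK (g := EFin \o f n)); exact/measurable_EFinP.
  - by move=> n x Xx; apply: (ge0K (g := EFin \o f n)) => // z; rewrite lee_fin.
  - move=> x Xx m n mn; apply: lee_sum => i _.
    by rewrite lee_wpmul2l ?lee_fin ?w_ge0 //; exact: nd.
rewrite (eq_cvg _ _ (fun n => stat_nnsfun (f n))) in l2.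
exact: (cvg_unique _ l2 l1).
Qed.


Lemma drift_null (D : set T) (L : T -> R) (C : R) :
  measurable D -> D `<=` X -> measurable_fun setT L ->
  (forall x, X x -> \sum_i w i x = 1) ->
  (forall i x, X x -> D (r i x) <-> D x) ->
  (forall i x, D x -> `|L (r i x) - L x| <= C) ->
  (forall x, D x -> \sum_i w i x * (L (r i x) - L x) < 0) ->
  pi D = 0%E.
Proof.
move=> mD DX mL w1 rD LC drift.
pose h (M : nat) x := \sum_i w i x * (clamp M%:R (L (r i x)) - clamp M%:R (L x)).
pose h' x := \sum_i w i x * (L (r i x) - L x).
have mclamp M : measurable_fun setT (fun x => clamp M (L x)).
  exact: measurable_clamp.
have mLr i : measurable_fun setT (fun x => L (r i x)) by exact: measurableT_comp.
have mclampr M i : measurable_fun setT (fun x => clamp M (L (r i x))).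
  exact: measurable_clamp.
have mh M : measurable_fun setT (h M).
  apply: measurable_sum => i; apply: measurable_funM => //.
  exact: measurable_funB.
have mh' : measurable_fun setT h'.
  apply: measurable_sum => i; apply: measurable_funM => //.
  exact: measurable_funB.
have w0 i x : D x -> 0 <= w i x by move=> /DX; exact: w_ge0.
(* A weighted mean, with weights of sum 1, of quantities dominated by the increments of [L] is again
   at most [C]. This serves both [h] and [h']. *)
have bound (F : I -> T -> R) x : D x -> (forall i, `|F i x| <= `|L (r i x) - L x|) ->
    `|\sum_i w i x * F i x| <= C.
  move=> Dx Fle; rewrite (le_trans (ler_norm_sum _ _ _))//.
  rewrite -[leRHS]mul1r -(w1 x (DX _ Dx)) mulr_suml ler_sum // => i _.
  rewrite normrM (ger0_norm (w0 _ _ Dx)) ler_wpM2l ?w0 //.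
  by rewrite (le_trans (Fle i)) ?LC.
have hC (M : nat) x : D x -> `|h M x| <= C.
  move=> Dx; apply: (bound (fun i x => clamp M%:R (L (r i x)) - clamp M%:R (L x))) => // i.
  exact: clamp_lipschitz.
have inth M : (\int[pi]_(x in D) (h M x)%:E = 0)%E.
  (* Adding [M] makes the truncation nonnegative, so that the integral identity applies; extending
     by zero outside [D] localizes it. *)
  pose g : T -> \bar R := (fun x => (clamp M%:R (L x) + M%:R)%:E) \_ D.
  have gp x : (0 <= (clamp M%:R (L x) + M%:R)%:E :> \bar R)%E.
    by rewrite lee_fin -lerBlDr sub0r clamp_ge.
  have mgp : measurable_fun setT (fun x => (clamp M%:R (L x) + M%:R)%:E : \bar R).
    by apply/measurable_EFinP; apply: measurable_funD.
  have g0 x : (0 <= g x)%E by rewrite /g patchE; case: ifP.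
  have mg : measurable_fun setT g.
    by apply/(measurable_restrictT _ mD); exact: measurable_funTS.
  have := stationary_ge0_integral mg g0.
  rewrite /g -[RHS]integral_mkcond => Eg.
  (* Invariance of [D] lets the cut-off pass through the kernel: from [D] every branch stays in [D],
     and from the rest of [X] none enters it. *)
  have EX : (\int[pi]_(x in X) \sum_i (w i x)%:E * g (r i x) =
     \int[pi]_(x in D) (\sum_i w i x * (clamp M%:R (L (r i x)) + M%:R))%:E)%E.
    rewrite -[in RHS](setIidr DX) integral_mkcondr.
    apply: eq_integral => x /[!inE] Xx; rewrite patchE.
    case: (pselect (D x)) => Dx; [rewrite mem_set // | rewrite memNset //].
      rewrite -sumEFin; apply: eq_bigr => i _.
      by rewrite /g patchE mem_set ?EFinM //; apply/rD.
    rewrite big1 // => i _; rewrite /g patchE memNset ?mule0 //.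
    by move/(rD _ _ Xx).
  rewrite EX in Eg.
  have fin1 : pi.-integrable D (EFin \o (fun x => clamp M%:R (L x) + M%:R)).
    apply: (@bounded_integrable _ _ _ _ _ _ (M%:R + M%:R)) => // [|x Dx].
      by apply: measurable_funTS; apply: measurable_funD.
    rewrite (le_trans (ler_normD _ _)) // [`|M%:R|]ger0_norm // lerD2r.
    exact: clamp_norm.
  (* As the weights sum to 1, the shift by [M] cancels in the difference. *)
  have -> : (\int[pi]_(x in D) (h M x)%:E = \int[pi]_(x in D)
    ((\sum_i w i x * (clamp M%:R (L (r i x)) + M%:R))%:E - (clamp M%:R (L x) + M%:R)%:E))%E.
    apply: eq_integral => x /[!inE] Dx; rewrite -EFinB; congr EFin.
    rewrite /h -[X in _ = _ - X]mul1r -(w1 _ (DX _ Dx)) mulr_suml -sumrB.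
    by apply: eq_bigr => i _; rewrite -mulrBr; congr (_ * _); ring.
  rewrite integralB //; last first.
    apply: (@bounded_integrable _ _ _ pi D _ (M%:R + M%:R)) => // [|x Dx].
      apply: measurable_funTS; apply: measurable_sum => i; apply: measurable_funM => //.
      exact: measurable_funD.
    rewrite (le_trans (ler_norm_sum _ _ _)) //.
    have -> : M%:R + M%:R = \sum_i w i x * (M%:R + M%:R).
      by rewrite -mulr_suml w1 ?mul1r //; exact: DX.
    apply: ler_sum => i _.
    rewrite normrM (ger0_norm (w0 _ _ Dx)) ler_wpM2l ?w0 //.
    rewrite (le_trans (ler_normD _ _)) // [`|M%:R|]ger0_norm // lerD2r.
    exact: clamp_norm.
  rewrite Eg subee //; exact: integrable_fin_num.
have hcvg x : h n x @[n --> \oo] --> h' x.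
  apply: cvg_big => [|i _]; first exact: add_continuous.
  apply: cvgMr; apply: cvgB; exact: cvg_clamp.
have inth' : (\int[pi]_(x in D) (h' x)%:E = 0)%E.
  have := @dominated_cvg _ _ _ pi D mD (fun n x => (h n x)%:E) (fun x => (h' x)%:E)
    (fun=> C%:E).
  under eq_cvg do rewrite inth.
  move=> dc; apply: (cvg_unique (@ereal_hausdorff R) (dc _ _ _ _ _) (cvg_cst 0%E)) => //.
  - by move=> n; apply/measurable_EFinP; exact: measurable_funTS.
  - by move=> x Dx; apply: cvg_EFin; [exact: nearW|exact: hcvg].
  - exact: finite_measure_integrable_cst.
(* Since [h'] is negative on [D], its absolute value integrates to zero as well. Hence [h'] vanishes
   almost everywhere on [D], yet it vanishes nowhere there. *)
have : (\int[pi]_(x in D) `|(h' x)%:E| = 0)%E.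
  rewrite -[RHS]oppe0 -inth' -integralN.
    apply: eq_integral => x /[!inE] Dx.
    by rewrite abse_EFin ltr0_norm // drift.
  apply/integrable_add_def/(@bounded_integrable _ _ _ pi D h' C) => //.
    exact: measurable_funTS.
  by move=> x Dx; apply: (bound (fun i x => L (r i x) - L x)).
move=> /(ae_eq_integral_abs _ mD) [].
  by apply/measurable_EFinP; exact: measurable_funTS.
move=> N [mN N0 sN].
apply: (subset_measure0 mD mN) => //.
move=> x Dx; apply: sN => /= /(_ Dx) [] /eqP; apply/negP.
by rewrite lt_eqF // drift.
Qed.

End FiniteBranching.

(** * The multiplicative weights map of a single agent *)

Lemma measurable_invr (R : realType) : measurable_fun [set: R] (@GRing.inv R).
Proof.
(* Passing to the square makes the base nonnegative, where the inverse is the real power with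
   exponent -1. At 0 both sides are 0 by convention. *)
have -> : @GRing.inv R = (fun x : R => x * (x ^+ 2) `^ (-1)).
  apply/funext => x; rewrite powR_inv1 ?sqr_ge0 //.
  have [->|x0] := eqVneq x 0; first by rewrite invr0 mul0r.
  by field.
apply: measurable_funM => //.
exact: (measurableT_comp (measurable_powR (-1)) (exprn_measurable 2)).
Qed.

Section MultiplicativeWeights.
Context {R : realType} {n : nat}.
Implicit Types (x : n.-tuple R) (u : 'I_n -> R).

(** One agent's component of [mwu_update], with [u] the payoffs already multiplied by the learning
    rate; both agents share its analysis. *)
Definition mw x u : n.-tuple R :=
  [tuple tnth x h * expR (u h) / (\sum_(b < n) tnth x b * expR (u b)) | h < n].

Lemma simplex_sum_gt0 x (F : 'I_n -> R) : simplex x -> (forall i, 0 < F i) ->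
  0 < \sum_(i < n) tnth x i * F i.
Proof.
move=> [x0 x1] F0.
have xF0 i : 0 <= tnth x i * F i by rewrite mulr_ge0 // ltW.
rewrite lt_neqAle sumr_ge0 // andbT eq_sym psumr_neq0 //.
have : \sum_(i < n) tnth x i != 0 by rewrite x1 oner_neq0.
rewrite psumr_neq0 // => /hasP[b bn xb]; apply/hasP; exists b => //=.
by rewrite mulr_gt0.
Qed.

Lemma mw_norm_gt0 x u : simplex x -> 0 < \sum_(b < n) tnth x b * expR (u b).
Proof. by move=> sx; apply: simplex_sum_gt0 => // i; exact: expR_gt0. Qed.

Lemma mw_simplex x u : simplex x -> simplex (mw x u).
Proof.
move=> sx; have Z := mw_norm_gt0 u sx; case: sx => x0 x1; split=> [i|].
  by rewrite tnth_mktuple divr_ge0 ?(ltW Z) // mulr_ge0 ?expR_ge0.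
under eq_bigr do rewrite tnth_mktuple.
by rewrite -mulr_suml divff // gt_eqF.
Qed.

Lemma mw_gt0 x u i : simplex x -> (0 < tnth (mw x u) i) = (0 < tnth x i).
Proof.
move=> sx; have Z := mw_norm_gt0 u sx.
by rewrite tnth_mktuple pmulr_lgt0 ?invr_gt0 // pmulr_lgt0 ?expR_gt0.
Qed.

(** In logarithmic coordinates the update is a translation by [u], up to a normalizer common to all
    coordinates. This is why [L] is built from logarithms. *)
Lemma ln_mw x u i : simplex x -> 0 < tnth x i ->
  ln (tnth (mw x u) i) - ln (tnth x i) =
  u i - ln (\sum_(b < n) tnth x b * expR (u b)).
Proof.
move=> sx xi; have Z := mw_norm_gt0 u sx.
rewrite tnth_mktuple ln_div ?posrE ?mulr_gt0 ?expR_gt0 //.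
by rewrite lnM ?posrE ?expR_gt0 // expRK; ring.
Qed.

(** The normalizer is a weighted mean of exponentials lying between [expR (- K)] and [expR K]. The
    bound is uniform in [x], although the logarithms of the coordinates are unbounded. *)
Lemma norm_ln_mw_norm x u K : simplex x -> (forall b, `|u b| <= K) ->
  `|ln (\sum_(b < n) tnth x b * expR (u b))| <= K.
Proof.
move=> sx uK; have Z := mw_norm_gt0 u sx; case: sx => x0 x1.
have uK' b : - K <= u b <= K by rewrite -ler_norml.
have cE c : expR c = \sum_(b < n) tnth x b * expR c by rewrite -mulr_suml x1 mul1r.
rewrite ler_norml; apply/andP; split.
  rewrite -[leLHS]expRK ler_ln ?posrE ?expR_gt0 // cE; apply: ler_sum => b _.
  by rewrite ler_wpM2l // ler_expR; case/andP: (uK' b).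
rewrite -[leRHS]expRK ler_ln ?posrE ?expR_gt0 // cE; apply: ler_sum => b _.
by rewrite ler_wpM2l // ler_expR; case/andP: (uK' b).
Qed.

Lemma mw_basis_vec (s : 'I_n) u : mw (basis_vec R s) u = basis_vec R s.
Proof.
have E : \sum_(b < n) tnth (basis_vec R s) b * expR (u b) = expR (u s).
  rewrite (bigD1 s) //= tnth_mktuple eqxx mul1r big1 ?addr0 // => b /negPf bs.
  by rewrite tnth_mktuple bs mul0r.
apply: eq_from_tnth => i; rewrite /mw tnth_mktuple E tnth_mktuple.
by case: eqP => [->|_]; rewrite ?mul1r ?divff ?gt_eqF ?expR_gt0 // !mul0r.
Qed.

Lemma measurable_mw u : measurable_fun setT (mw^~ u).
Proof.
apply/measurable_fun_tnthP => i.
rewrite (_ : _ \o _ = (fun x => tnth x i * expR (u i) *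
   (\sum_(b < n) tnth x b * expR (u b))^-1)); last first.
  by apply/funext => x /=; rewrite tnth_mktuple.
have mt b : measurable_fun setT (fun x => tnth x b * expR (u b)).
  by apply: measurable_funM => //; exact: measurable_tnth.
apply: measurable_funM => //.
apply: (measurableT_comp (@measurable_invr R)).
exact: measurable_sum.
Qed.

End MultiplicativeWeights.

(** * Open faces of the simplex *)

Section Faces.
Context {R : realType} {n : nat}.

Lemma measurable_tuple_forall (P : 'I_n -> set R) :
  (forall i, measurable (P i)) ->
  measurable [set x : n.-tuple R | forall i, P i (tnth x i)].
Proof.
move=> mP.
have -> : [set x : n.-tuple R | forall i, P i (tnth x i)] =
    \bigcap_(i in [set: 'I_n]) ((@tnth n R ^~ i) @^-1` P i).
  by apply/seteqP; split => x /= h i; [move=> _; exact: h | exact: h].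
apply: fin_bigcap_measurable => // i _.
by rewrite -[X in measurable X]setTI; exact: measurable_tnth.
Qed.

Lemma measurable_simplex : measurable (@simplex R n).
Proof.
have -> : @simplex R n = [set x | forall i, [set t | 0 <= t] (tnth x i)] `&`
    (fun x : n.-tuple R => \sum_(i < n) tnth x i) @^-1` [set 1] by [].
apply: measurableI.
  apply: (@measurable_tuple_forall (fun=> [set t | 0 <= t])) => _.
  by rewrite (_ : [set t : R | 0 <= t] = `[0, +oo[%classic) //;
    apply/seteqP; split => t /=; rewrite in_itv /= andbT.
rewrite -[X in measurable X]setTI.
have : measurable_fun setT (fun x : n.-tuple R => \sum_(i < n) tnth x i).
  by apply: measurable_sum => i; exact: measurable_tnth.
exact.
Qed.

(** The support is exactly [S], so these are relatively open faces: they partition the simplex, and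
    coordinates in [S] have genuine logarithms. *)
Definition face (S : {set 'I_n}) : set (n.-tuple R) :=
  @simplex R n `&` [set x | forall i, (0 < tnth x i) = (i \in S)].

Lemma measurable_face (S : {set 'I_n}) : measurable (face S).
Proof.
apply: measurableI; first exact: measurable_simplex.
apply: (@measurable_tuple_forall (fun i => [set t | (0 < t) = (i \in S)])) => i.
have m0 : measurable [set t : R | 0 < t].
  by rewrite (_ : [set t : R | 0 < t] = `]0, +oo[%classic) //;
    apply/seteqP; split => t /=; rewrite in_itv /= andbT.
case: (i \in S) => //.
rewrite (_ : [set t : R | _] = ~` [set t : R | 0 < t]); first exact: measurableC.
by apply/seteqP; split => t /=; [move=> -> | move/negP/negPf].
Qed.

Lemma measurable_tuple_set1 (x : n.-tuple R) : measurable [set x].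
Proof.
have -> : [set x] = [set y | forall i, [set tnth x i] (tnth y i)].
  by apply/seteqP; split => y /= => [-> // | h]; exact: eq_from_tnth.
by apply: (@measurable_tuple_forall (fun i => [set tnth x i])).
Qed.

Lemma mw_face (S : {set 'I_n}) (x : n.-tuple R) (u : 'I_n -> R) :
  simplex x -> face S (mw x u) <-> face S x.
Proof.
move=> sx; split => -[_ h]; split => //; try exact: mw_simplex; move=> i;
  by have := h i; rewrite mw_gt0.
Qed.

Lemma face_card_gt0 (x : n.-tuple R) (S : {set 'I_n}) : face S x -> (0 < #|S|)%N.
Proof.
move=> [[x0 x1] xS]; rewrite card_gt0; apply/negP => /eqP S0.
have : \sum_(i < n) tnth x i != 0 by rewrite x1 oner_neq0.
rewrite psumr_neq0 // => /hasP[i _] /=.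
by rewrite xS S0 inE.
Qed.

Lemma face_eq0 (x : n.-tuple R) (S : {set 'I_n}) i :
  face S x -> i \notin S -> tnth x i = 0.
Proof.
by move=> [[x0 _] xS] iS; apply/eqP; rewrite eq_le x0 andbT leNgt xS.
Qed.

Lemma face_set1 (x : n.-tuple R) (S : {set 'I_n}) :
  face S x -> (#|S| <= 1)%N -> exists s, x = basis_vec R s.
Proof.
move=> xf; have := face_card_gt0 xf => S0 S1.
have /cards1P[s Ss] : #|S| == 1%N by rewrite eqn_leq S1 S0.
have xi i : i != s -> tnth x i = 0.
  by move=> si; apply: face_eq0 xf _; rewrite Ss inE.
exists s; apply: eq_from_tnth => i; rewrite tnth_mktuple.
have [->|si] := eqVneq i s; last exact: xi.
have [[_ <-] _] := xf.
by rewrite (bigD1 s) //= big1 ?addr0 // => j; exact: xi.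
Qed.

Lemma face_supp (x : n.-tuple R) : simplex x -> face [set i | 0 < tnth x i]%SET x.
Proof. by move=> sx; split => // i; rewrite inE. Qed.

End Faces.

(** * The zero-sum game: sampling probabilities and Jensen gaps *)

Section Game.
Context {R : realType} {n1 n2 : nat}.
Variables (A : 'M[R]_(n1, n2)) (eta1 eta2 : R).
Hypotheses (eta1_gt0 : 0 < eta1) (eta2_gt0 : 0 < eta2).
Hypothesis A_distinct : injective (fun s : 'I_n1 * 'I_n2 => A s.1 s.2).

Local Notation profile := (profile R n1 n2).
Local Notation X := (@Xspace R n1 n2).
Local Notation upd := (mwu_update A eta1 eta2).

(** In [u1] and [u2] the first argument is the opponent's sampled action, the second the agent's
    own. *)
Let u1 (j : 'I_n2) (i : 'I_n1) : R := eta1 * A i j.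
Let u2 (i : 'I_n1) (j : 'I_n2) : R := eta2 * - A i j.

Let lnZ1 (x : profile) j := ln (\sum_(b < n1) tnth x.1 b * expR (u1 j b)).
Let lnZ2 (x : profile) i := ln (\sum_(b < n2) tnth x.2 b * expR (u2 i b)).

Definition play_prob (s : 'I_n1 * 'I_n2) (x : profile) : R := tnth x.1 s.1 * tnth x.2 s.2.

Lemma play_prob_ge0 s x : X x -> 0 <= play_prob s x.
Proof. by move=> [[h _] [h' _]]; rewrite mulr_ge0. Qed.

Lemma play_prob_sum1 x : X x -> \sum_s play_prob s x = 1.
Proof.
move=> [[_ h] [_ h']].
rewrite -(pair_bigA _ (fun i j => tnth x.1 i * tnth x.2 j)) /=.
by rewrite -h; apply: eq_bigr => i _; rewrite -mulr_sumr h' mulr1.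
Qed.

Lemma play_prob_sum1l x (F : 'I_n2 -> R) : X x ->
  \sum_s play_prob s x * F s.2 = \sum_j tnth x.2 j * F j.
Proof.
move=> [[_ h] _].
rewrite -(pair_bigA _ (fun i j => tnth x.1 i * tnth x.2 j * F j)) exchange_big /=.
by apply: eq_bigr => j _; rewrite -mulr_suml -mulr_suml h mul1r.
Qed.

Lemma play_prob_sum1r x (F : 'I_n1 -> R) : X x ->
  \sum_s play_prob s x * F s.1 = \sum_i tnth x.1 i * F i.
Proof.
move=> [_ [_ h]].
rewrite -(pair_bigA _ (fun i j => tnth x.1 i * tnth x.2 j * F i)) /=.
by apply: eq_bigr => i _; rewrite -mulr_suml -mulr_sumr h mulr1.
Qed.

Lemma jensen_gap1_ge0 x j : X x -> 0 <= eta1^-1 * lnZ1 x j - \sum_i tnth x.1 i * A i j.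
Proof.
move=> [[x0 x1] _]; rewrite subr_ge0 ler_pdivlMl // mulr_sumr.
apply: le_trans (jensen_ln_sum_expR (u1 j) x0 x1).
by apply: ler_sum => i _; rewrite /u1 mulrCA.
Qed.

(** Distinct entries within column [j] make the exponents at [a] and [b] differ, so Jensen is strict
    whatever the opponent plays. *)
Lemma jensen_gap1_gt0 x j a b : X x -> 0 < tnth x.1 a -> 0 < tnth x.1 b -> a != b ->
  0 < eta1^-1 * lnZ1 x j - \sum_i tnth x.1 i * A i j.
Proof.
move=> [[x0 x1] _] xa xb ab; rewrite subr_gt0 ltr_pdivlMl // mulr_sumr.
have uab : u1 j a != u1 j b.
  apply: contraNneq ab => /(mulfI (lt0r_neq0 eta1_gt0)) Eab.
  by have [->] := A_distinct (x1 := (a, j)) (x2 := (b, j)) Eab.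
apply: le_lt_trans (jensen_ln_sum_expR_lt x0 x1 xa xb uab).
by apply: ler_sum => i _; rewrite /u1 mulrCA.
Qed.

(** The plus sign is that of a Jensen gap for the payoffs [- A i j] of the second agent. *)
Lemma jensen_gap2_ge0 x i : X x -> 0 <= eta2^-1 * lnZ2 x i + \sum_j tnth x.2 j * A i j.
Proof.
move=> [_ [x0 x1]]; rewrite -[X in _ + X]opprK subr_ge0 ler_pdivlMl // mulrN mulr_sumr -sumrN.
apply: le_trans (jensen_ln_sum_expR (u2 i) x0 x1).
by apply: ler_sum => j _; rewrite /u2 !mulrN mulrCA.
Qed.

Lemma jensen_gap2_gt0 x i a b : X x -> 0 < tnth x.2 a -> 0 < tnth x.2 b -> a != b ->
  0 < eta2^-1 * lnZ2 x i + \sum_j tnth x.2 j * A i j.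
Proof.
move=> [_ [x0 x1]] xa xb ab.
rewrite -[X in _ + X]opprK subr_gt0 ltr_pdivlMl // mulrN mulr_sumr -sumrN.
have uab : u2 i a != u2 i b.
  apply: contraNneq ab => /(mulfI (lt0r_neq0 eta2_gt0))/oppr_inj Eab.
  by have [->] := A_distinct (x1 := (i, a)) (x2 := (i, b)) Eab.
apply: le_lt_trans (jensen_ln_sum_expR_lt x0 x1 xa xb uab).
by apply: ler_sum => j _; rewrite /u2 !mulrN mulrCA.
Qed.

(* The payoff terms of the two agents cancel, the game being zero-sum. *)
Lemma sum_jensen_gaps x : X x ->
  \sum_s play_prob s x * (eta1^-1 * lnZ1 x s.2 + eta2^-1 * lnZ2 x s.1) =
  \sum_j tnth x.2 j * (eta1^-1 * lnZ1 x j - \sum_i tnth x.1 i * A i j) +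
  \sum_i tnth x.1 i * (eta2^-1 * lnZ2 x i + \sum_j tnth x.2 j * A i j).
Proof.
move=> Xx.
have E : \sum_j tnth x.2 j * (\sum_i tnth x.1 i * A i j) =
    \sum_i tnth x.1 i * (\sum_j tnth x.2 j * A i j).
  under eq_bigr do rewrite mulr_sumr.
  under [RHS]eq_bigr do rewrite mulr_sumr.
  by rewrite exchange_big /=; apply: eq_bigr => i _; apply: eq_bigr => j _; rewrite mulrCA.
under eq_bigr do rewrite mulrDr.
rewrite big_split /= (play_prob_sum1l (fun j => eta1^-1 * lnZ1 x j)) //.
rewrite (play_prob_sum1r (fun i => eta2^-1 * lnZ2 x i)) //.
under [X in _ = X + _]eq_bigr do rewrite mulrBr.
under [X in _ = _ + X]eq_bigr do rewrite mulrDr.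
by rewrite sumrB big_split /= E; ring.
Qed.

(** An agent mixing at least two actions has a positive gap against every opposing action, hence a
    positive mean gap; the other agent contributes a nonnegative amount. *)
Lemma sum_jensen_gaps_gt0 (S1 : {set 'I_n1}) (S2 : {set 'I_n2}) x :
  face S1 x.1 -> face S2 x.2 -> (1 < #|S1|)%N || (1 < #|S2|)%N ->
  0 < \sum_s play_prob s x * (eta1^-1 * lnZ1 x s.2 + eta2^-1 * lnZ2 x s.1).
Proof.
move=> [sx1 xS1] [sx2 xS2] S12; have Xx : X x by [].
rewrite sum_jensen_gaps //; case/orP: S12 => /card_gt1P[a [b [aS bS ab]]].
  apply: ltr_wpDr.
    by apply: sumr_ge0 => i _; rewrite mulr_ge0 ?jensen_gap2_ge0 //; case: sx1.
  apply: simplex_sum_gt0 => // j.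
  by apply: (@jensen_gap1_gt0 _ _ a b) => //; rewrite xS1.
apply: ltr_wpDl.
  by apply: sumr_ge0 => i _; rewrite mulr_ge0 ?jensen_gap1_ge0 //; case: sx2.
apply: simplex_sum_gt0 => // j.
by apply: (@jensen_gap2_gt0 _ _ a b) => //; rewrite xS2.
Qed.

Lemma updE s x : upd s x = (mw x.1 (u1 s.2), mw x.2 (u2 s.1)).
Proof. by []. Qed.

Lemma upd_X s x : X x -> X (upd s x).
Proof. by move=> [? ?]; split; exact: mw_simplex. Qed.

Lemma measurable_upd s : measurable_fun setT (upd s).
Proof.
apply/measurable_fun_pairP; split.
  by apply: (measurableT_comp (measurable_mw (u1 s.2))).
by apply: (measurableT_comp (measurable_mw (u2 s.1))).
Qed.

Lemma measurable_tnth_fst i : measurable_fun setT (fun x : profile => tnth x.1 i).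
Proof. exact: (measurableT_comp (measurable_tnth i)). Qed.

Lemma measurable_tnth_snd i : measurable_fun setT (fun x : profile => tnth x.2 i).
Proof. exact: (measurableT_comp (measurable_tnth i)). Qed.

Lemma measurable_play_prob s : measurable_fun setT (play_prob s).
Proof.
apply: measurable_funM; [exact: measurable_tnth_fst | exact: measurable_tnth_snd].
Qed.

Lemma measurable_Xspace : measurable X.
Proof. by apply: measurableX; exact: measurable_simplex. Qed.

Lemma upd_face (S1 : {set 'I_n1}) (S2 : {set 'I_n2}) s x : X x ->
  (face S1 `*` face S2) (upd s x) <-> (face S1 `*` face S2) x.
Proof.
move=> [sx1 sx2]; split => -[h1 h2]; split => //=.
- exact/(mw_face _ (u1 s.2)).
- exact/(mw_face _ (u2 s.1)).
- exact/mw_face.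
- exact/mw_face.
Qed.

(** * Non-vertex faces are null for a stationary measure *)

Section FaceNull.
Variables (pi : probability profile R).
Hypothesis pi_X : pi X = 1%E.
Hypothesis pi_stat : smwu_stationary A eta1 eta2 pi.

Lemma smwu_kernelE x B : smwu_kernel A eta1 eta2 x B =
  (\sum_s play_prob s x * \1_B (upd s x))%:E.
Proof. by rewrite /smwu_kernel -sumEFin; apply: eq_bigr => s _; rewrite EFinM diracE indicE. Qed.

Lemma pi_setIX B : measurable B -> pi (B `&` X) = pi B.
Proof.
move=> mB; have mX := measurable_Xspace.
have X0 : pi (~` X) = 0%E by rewrite probability_setC // pi_X subee.
rewrite [RHS](measureDI pi mB mX) [X in (X + _)%E](_ : _ = 0%E) ?add0e //.
by apply: (subset_measure0 _ _ _ X0); [exact: measurableD | exact: measurableC | move=> x []].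
Qed.

(** Stationarity is only given for subsets of [X]. Replacing [B] by its trace on [X] changes neither
    side: [pi] lives on [X], and the update preserves [X]. *)
Lemma stationary_measurable B : measurable B ->
  (\int[pi]_(x in X) (\sum_s play_prob s x * \1_B (upd s x))%:E = pi B)%E.
Proof.
move=> mB; rewrite -(pi_setIX mB) -pi_stat; last 2 first.
- by apply: measurableI => //; exact: measurable_Xspace.
- by move=> x [].
apply: eq_integral => x /[!inE] Xx; rewrite smwu_kernelE; congr EFin.
apply: eq_bigr => s _; congr (_ * _).
by rewrite !indicE in_setI [X in _ && X]mem_set ?andbT //; exact: upd_X.
Qed.

Lemma face_null (S1 : {set 'I_n1}) (S2 : {set 'I_n2}) :
  (1 < #|S1|)%N || (1 < #|S2|)%N -> pi (face S1 `*` face S2) = 0%E.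
Proof.
move=> S12.
have [p [q [a [c [d [pA qA pa qa acd]]]]]] := face_weights A S1 S2.
pose L (x : profile) : R := eta1^-1 * (\sum_(i in S1) p i * ln (tnth x.1 i)) +
  eta2^-1 * (\sum_(j in S2) q j * ln (tnth x.2 j)).
pose K := \big[Num.max/0]_(s : 'I_n1 * 'I_n2) `|A s.1 s.2|.
have AK i j : `|A i j| <= K by exact: (@le_bigmax _ _ _ _ _ (i, j)).
have LE s x : (face S1 `*` face S2) x -> L (upd s x) - L x =
    eta1^-1 * (\sum_(i in S1) p i * (u1 s.2 i - lnZ1 x s.2)) +
    eta2^-1 * (\sum_(j in S2) q j * (u2 s.1 j - lnZ2 x s.1)).
  move=> [/= [sx1 xS1] [sx2 xS2]]; rewrite /L opprD addrACA -!mulrBr -!sumrB.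
  congr (_ * _ + _ * _); apply: eq_bigr => i iS; rewrite -mulrBr ln_mw //.
    by rewrite xS1.
  by rewrite xS2.
(* Each logarithm moves by an exponent minus a log-normalizer, both at most [eta1 * K] (or
   [eta2 * K]) in absolute value. *)
apply: (@drift_null _ _ _ _ pi X play_prob upd _ _ _ _ _ _ L
  (eta1^-1 * (\sum_(i in S1) `|p i| * (eta1 * K + eta1 * K)) +
   eta2^-1 * (\sum_(j in S2) `|q j| * (eta2 * K + eta2 * K)))) => //.
- exact: measurable_Xspace.
- exact: measurable_play_prob.
- exact: measurable_upd.
- by move=> s x; exact: play_prob_ge0.
- exact: stationary_measurable.
- by apply: measurableX; exact: measurable_face.
- by move=> x [[? _] [? _]].
- apply: measurable_funD; apply: measurable_funM => //.
    under eq_fun do rewrite -big_enum; apply: measurable_sum => i.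
    apply: measurable_funM => //.
    exact: (measurableT_comp (@measurable_ln R) (measurable_tnth_fst i)).
  under eq_fun do rewrite -big_enum; apply: measurable_sum => j.
  apply: measurable_funM => //.
  exact: (measurableT_comp (@measurable_ln R) (measurable_tnth_snd j)).
- exact: play_prob_sum1.
- exact: upd_face.
- move=> s x Fx; rewrite LE //; case: Fx => [/= [sx1 xS1] [sx2 xS2]].
  have u1K j i : `|u1 j i| <= eta1 * K.
    by rewrite normrM gtr0_norm // ler_wpM2l // ltW.
  have u2K i j : `|u2 i j| <= eta2 * K.
    by rewrite normrM normrN gtr0_norm // ler_wpM2l // ltW.
  rewrite (le_trans (ler_normD _ _)) // !normrM.
  rewrite [`|eta1^-1|]gtr0_norm ?invr_gt0 // [`|eta2^-1|]gtr0_norm ?invr_gt0 //.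
  apply: lerD; (apply: ler_wpM2l; first by rewrite invr_ge0 ltW);
    rewrite (le_trans (ler_norm_sum _ _ _)) //; apply: ler_sum => i _;
    rewrite normrM ler_wpM2l // (le_trans (ler_normB _ _)) // lerD //;
    exact: norm_ln_mw_norm.
(* By the choice of [p] and [q] the payoff part of the increment is [c - d] for every sampled [s] in
   the supports, not merely on average. Other [s] have probability zero. *)
- move=> x Fx; rewrite (eq_bigr (fun s => play_prob s x *
    (c - d - a * (eta1^-1 * lnZ1 x s.2 + eta2^-1 * lnZ2 x s.1)))); last first.
    move=> s _.
    have [s1|s1] := boolP (s.1 \in S1); last first.
      by rewrite /play_prob (face_eq0 Fx.1 s1) !mul0r.
    have [s2|s2] := boolP (s.2 \in S2); last first.
      by rewrite /play_prob (face_eq0 Fx.2 s2) mulr0 !mul0r.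
    congr (_ * _); rewrite LE //.
    under eq_bigr do rewrite mulrBr mulrCA.
    under [X in _ + _ * X]eq_bigr do rewrite mulrBr mulrCA mulrN.
    rewrite !sumrB -!mulr_sumr -!mulr_suml pa qa sumrN pA // qA //.
    by field; rewrite !gt_eqF.
  case: Fx => F1 F2.
  have Xx : X x by split; [case: F1 | case: F2].
  under eq_bigr do rewrite mulrBr mulrCA.
  rewrite sumrB -mulr_suml -mulr_sumr play_prob_sum1 // mul1r.
  (* For [a = 0] the drift is the constant [c - d]; for [a = 1] it is minus the mean sum of Jensen
     gaps. *)
  case: acd => -[-> cd]; last by rewrite mul0r subr0 subr_lt0.
  by rewrite cd subrr sub0r mul1r oppr_lt0 (@sum_jensen_gaps_gt0 S1 S2).
Qed.

End FaceNull.

(** * The two implications *)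

Lemma measurable_pure_profiles : measurable (@pure_profiles R n1 n2).
Proof.
rewrite (_ : @pure_profiles R n1 n2 = \bigcup_(s in [set: 'I_n1 * 'I_n2])
  ([set basis_vec R s.1] `*` [set basis_vec R s.2])).
  apply: fin_bigcup_measurable => // s _.
  by apply: measurableX; exact: measurable_tuple_set1.
apply/seteqP; split=> [x [s1 [s2 ->]]|[x1 x2] [[s1 s2] _] /= [-> ->]].
  by exists (s1, s2).
by exists s1, s2.
Qed.

Lemma stationary_pure (pi : probability profile R) :
  pi X = 1%E -> smwu_stationary A eta1 eta2 pi -> pi (@pure_profiles R n1 n2) = 1%E.
Proof.
move=> pi_X pi_stat; have mP := measurable_pure_profiles.
have mX := measurable_Xspace.
(* Faces with two singleton supports are replaced by the empty set, so a single finite union over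
   all pairs of supports is null. *)
pose N (S : {set 'I_n1} * {set 'I_n2}) : set profile :=
  if (1 < #|S.1|)%N || (1 < #|S.2|)%N then face S.1 `*` face S.2 else set0.
have N0 S : pi.-negligible (N S).
  rewrite /N; case: ifP => [S12|_]; last exact: negligible_set0.
  apply/negligibleP; last exact: face_null.
  by apply: measurableX; exact: measurable_face.
have UN : pi.-negligible (\big[setU/set0]_S N S).
  by elim/big_ind : _ => // [|? ?]; [exact: negligible_set0 | exact: negligibleU].
have X0 : pi.-negligible (~` X).
  apply/negligibleP; first exact: measurableC.
  suff : pi (~` X) = 0%E by [].
  by rewrite probability_setC // pi_X subee.
have : pi.-negligible (~` @pure_profiles R n1 n2).
  apply: negligibleS (negligibleU X0 UN) => x xP.
  have [Xx|] := pselect (X x); last by left.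
  right; rewrite -bigcup_seq /=; have [sx1 sx2] := Xx.
  have F1 := face_supp sx1; have F2 := face_supp sx2.
  exists ([set i | 0 < tnth x.1 i]%SET, [set i | 0 < tnth x.2 i]%SET).
    by rewrite /= mem_index_enum.
  rewrite /N /=; case: ifPn => //.
  (* If both supports of [x] have at most one element, then [x] is pure, against the assumption. *)
  rewrite negb_or -!leqNgt => /andP[S1 S2]; apply: xP.
  have [s1 E1] := face_set1 F1 S1; have [s2 E2] := face_set1 F2 S2.
  by exists s1, s2; rewrite -E1 -E2; case: (x).
move/(negligibleP pi (measurableC mP)) => P0.
have : pi (~` @pure_profiles R n1 n2) = 0%E by [].
by rewrite probability_setC // => /eqP; rewrite sube_eq ?fin_num_measure // ?add0e // => /eqP/esym.
Qed.

(** At a pure profile only that profile can be sampled, and the update fixes it. The kernel is thus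
    the Dirac mass there, and it agrees almost everywhere with the indicator of [B]. *)
Lemma pure_stationary (pi : probability profile R) :
  pi X = 1%E -> pi (@pure_profiles R n1 n2) = 1%E -> smwu_stationary A eta1 eta2 pi.
Proof.
move=> pi_X pi_P B mB BX; have mP := measurable_pure_profiles.
have mX := measurable_Xspace.
transitivity (\int[pi]_(x in X) (\1_B x)%:E)%E; last first.
  by rewrite integral_indic // setIidl.
apply: ge0_ae_eq_integral => //.
- under eq_fun do rewrite smwu_kernelE.
  apply/measurable_EFinP/measurable_sum => s; apply: measurable_funM.
    exact: measurable_funTS (measurable_play_prob s).
  apply: measurable_funTS; apply: (measurableT_comp _ (measurable_upd s)).
  exact: measurable_indic.
- by apply/measurable_EFinP; exact: measurable_indic.
- move=> x Xx; rewrite smwu_kernelE lee_fin sumr_ge0 // => s _.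
  by rewrite mulr_ge0 ?play_prob_ge0.
- exists (~` @pure_profiles R n1 n2); split; first exact: measurableC.
    suff : pi (~` @pure_profiles R n1 n2) = 0%E by [].
    by rewrite probability_setC // pi_P subee.
  apply: subsetC => x [s1 [s2 ->]] _; rewrite smwu_kernelE; congr EFin.
  rewrite (bigD1 (s1, s2)) //= big1 ?addr0.
    by rewrite /play_prob updE !mw_basis_vec !tnth_mktuple !eqxx !mul1r.
  move=> [t1 t2]; rewrite xpair_eqE negb_and /play_prob /= !tnth_mktuple => /orP[]/negPf->.
    by rewrite !mul0r.
  by rewrite mulr0 mul0r.
Qed.

End Game.

Theorem theorem7 (R : realType) (n1 n2 : nat) (A : 'M[R]_(n1, n2))
    (eta1 eta2 : R) (eta1_gt0 : 0 < eta1) (eta2_gt0 : 0 < eta2)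
    (A_distinct : injective (fun s : 'I_n1 * 'I_n2 => A s.1 s.2))
    (pi : probability (profile R n1 n2) R)
    (pi_X : pi (@Xspace R n1 n2) = 1%E) :
  smwu_stationary A eta1 eta2 pi <-> pi (@pure_profiles R n1 n2) = 1%E.
Proof.
split; first exact: stationary_pure.
exact: pure_stationary.
Qed.
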